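(* Let $c\ge 1$ be an integer and suppose that $q$ is a prime power, $c<q-1$ and $c$ divides $q-1$. Then $$P\left(\frac{q^2-1}{c}+1,\; q,\; c+1\right)\ \ge\ \frac{q^2-1}{c}+\left\lfloor\frac{q+1}{c}\right\rfloor .$$
   Context: For integers $k\ge t$, a $(v,k,t)$ packing of size $b$ is a system of $b$ subsets (blocks) of a $v$-element underlying set such that each block has exactly $k$ elements and every $t$-element set is contained in at most one block. $P(v,k,t)$ denotes the maximum possible size $b$ of a $(v,k,t)$ packing. *)

(* Defs.v *)
From mathcomp Require Import all_boot.

Set Implicit Arguments.
Unset Strict Implicit.
Unset Printing Implicit Defensive.

Definition prime_power (q : nat) : Prop :=
  exists p n : nat, [/\ prime p, 0 < n & q = p ^ n].

(* The blocks form a set of sets: when t <= k, which is the only case of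
   interest, a repeated block would put a t-set in two blocks, so a packing
   given as an indexed family never has repetitions. *)
Definition is_packing (X : finType) (k t : nat) (F : {set {set X}}) : bool :=
  [forall B in F, #|B| == k] &&
  [forall T : {set X}, (#|T| == t) ==> (#|[set B in F | T \subset B]| <= 1)].

(* The maximum is over a nonempty range, since the empty system is a packing. *)
Definition packing_number (v k t : nat) : nat :=
  \max_(F : {set {set 'I_v}} | is_packing k t F) #|F|.

(* Main.v *)
(* View the affine plane over F_q as K = F_{q^2}, and let mu_c be the group of
   c-th roots of unity, which lies in F_q because c divides q - 1.  The points
   are the orbits of mu_c on K, including {0}.  A line avoiding 0 meets each
   orbit at most once, so its image is a block of size q, and the q^2 - 1 such
   lines give (q^2 - 1) / c blocks; two of them share at most c points, since
   the c translates by mu_c of a line meet another at most once each.  The union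
   of c lines through 0 also has an image of size q, and the q + 1 lines
   through 0 can be grouped into floor((q + 1) / c) such blocks.  These
   pairwise meet in 0 only, and meet a block of the first kind in at most c points.

   The orbit of x is encoded by x ^ c, so the nonzero points are the
   (q^2 - 1) / c-th roots of unity. *)
Require Import Defs.
From mathcomp Require Import all_boot.
From mathcomp Require Import all_algebra all_field.
From mathcomp Require Import zify ring.

Set Implicit Arguments.
Unset Strict Implicit.
Unset Printing Implicit Defensive.

(** * Packings on arbitrary finite point sets *)

Lemma card_preim_enum_val (X : finType) (D A : {set X}) :
  A \subset D -> #|[set i : 'I_#|D| | enum_val i \in A]| = #|A|.
Proof.
move=> sAD; rewrite -(card_imset _ enum_val_inj); congr #|pred_of_set _|.
apply/setP=> x; apply/imsetP/idP=> [[i] + ->|Ax]; first by rewrite inE.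
have Dx := subsetP sAD x Ax.
by exists (enum_rank_in Dx x); rewrite ?inE enum_rankK_in.
Qed.

(** Lets the packing be built inside any finite type: [enum_val] transports blocks to ['I_#|D|]. A
    set of size [t + 1] in two blocks would lie in their intersection. *)
Lemma packing_number_ge (X I : finType) (D : {set X}) (B : I -> {set X})
    (k t : nat) :
    t < k -> (forall i, B i \subset D) -> (forall i, #|B i| = k) ->
    (forall i j, i != j -> #|B i :&: B j| <= t) ->
  #|I| <= packing_number #|D| k (t + 1).
Proof.
move=> ltk sBD cardB capB.
pose C i := [set x : 'I_#|D| | enum_val x \in B i].
have capC i j : i != j -> #|C i :&: C j| <= t.
  move/capB; rewrite -(@card_preim_enum_val _ D) ?subIset ?sBD //.
  by congr (_ <= _); apply: eq_card => x; rewrite !inE.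
(* Two equal blocks would intersect in [k > t] points, so no block is lost when the family becomes a
   set. *)
have injC : injective C.
  move=> i j eqC; apply/eqP; apply: contraTT ltk => /capC.
  by rewrite eqC setIid card_preim_enum_val // cardB -leqNgt.
rewrite -cardsT -(card_imset _ injC) /packing_number.
apply: leq_bigmax_cond.
apply/andP; split.
  by apply/forall_inP=> _ /imsetP[i _ ->]; rewrite card_preim_enum_val ?cardB.
apply/forallP=> T; apply/implyP=> /eqP cardT.
apply/card_le1_eqP=> P Q; rewrite !inE.
move=> /andP[/imsetP[i _ ->] sTi] /andP[/imsetP[j _ ->] sTj].
congr (C _); apply/eqP/negPn/negP=> /capC; apply/negP; rewrite -ltnNge -addn1.
by rewrite -cardT subset_leq_card // subsetI sTj.
Qed.

(** Inject a grid with rows of length [c] into [A]; the rows become the subsets. *)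
Lemma disjoint_subsets (T : finType) (A : {set T}) (c : nat) :
  exists S : 'I_(#|A| %/ c) -> {set T},
    [/\ forall j, S j \subset A, forall j, #|S j| = c &
        forall i j, i != j -> [disjoint S i & S j]].
Proof.
have le_card : #|{: 'I_(#|A| %/ c) * 'I_c}| <= #|A|.
  by rewrite card_prod !card_ord leq_divM.
pose f p := enum_val (widen_ord le_card (enum_rank p)).
have inj_f : injective f.
  move=> p1 p2 /enum_val_inj/(congr1 val)/= eq_rank.
  by apply/enum_rank_inj/val_inj.
exists (fun j => [set f (j, i) | i : 'I_c]); split=> [j | j | i j neq_ij].
- by apply/subsetP=> _ /imsetP[i _ ->]; apply: enum_valP.
- by rewrite card_imset ?card_ord // => i1 i2 /inj_f[].
- apply/pred0P=> x; apply/negbTE/negP=> /= /andP[/imsetP[i1 _ ->]].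
  case/imsetP=> j1 _ /inj_f[eq_ij].
  by rewrite eq_ij eqxx in neq_ij.
Qed.

Section Blocks.

Import GRing.Theory.
Local Open Scope ring_scope.

(** * Roots of unity in a finite field *)

Definition unity_roots (K : finFieldType) (n : nat) : {set K} :=
  [set z | z ^+ n == 1].

Lemma unity_roots_neq0 (K : finFieldType) (n : nat) (z : K) :
    (0 < n)%N -> z \in unity_roots K n -> z != 0.
Proof.
move=> n_gt0; apply: contraTneq => ->.
by rewrite inE expr0n gtn_eqF // eq_sym oner_eq0.
Qed.

Lemma prim_root_exists (K : finFieldType) (n : nat) :
  (n %| #|K|.-1)%N -> {z : K | n.-primitive_root z}.
Proof.
move=> dvd_n; suff /hasP/sig2W[z _ prim_z] :
    has (#|K|.-1).-primitive_root (enum [pred x : K | x != 0]).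
  by exists (z ^+ (#|K|.-1 %/ n)); exact: dvdn_prim_root.
have Kgt1 := finNzRing_gt1 K.
have cardK0 : #|[pred x : K | x != 0]| = #|K|.-1 by rewrite cardC1.
apply: cyclic.has_prim_root; rewrite ?enum_uniq -?cardE ?cardK0 //.
  by rewrite -ltnS prednK // ltnW.
apply/allP=> x; rewrite mem_enum unity_rootE inE => nz_x.
apply/eqP/(mulfI nz_x); rewrite mulr1 -exprS prednK ?expf_card //.
exact: ltnW.
Qed.

Lemma card_unity_roots (K : finFieldType) (n : nat) :
  (n %| #|K|.-1)%N -> #|unity_roots K n| = n.
Proof.
case/prim_root_exists=> z prim_z.
have injz : injective (fun i : 'I_n => z ^+ i).
  move=> i j /eqP; rewrite (eq_prim_root_expr prim_z) !modn_small //.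
  by move/eqP/val_inj.
rewrite -[RHS]card_ord -cardsT -(card_imset _ injz).
congr #|pred_of_set _|; apply/setP=> x; rewrite inE.
apply/eqP/imsetP=> [/(prim_rootP prim_z)[i ->]|[i _ ->]]; first by exists i.
by rewrite exprAC (prim_expr_order prim_z) expr1n.
Qed.

Lemma unity_rootsX (K : finFieldType) (m n : nat) (u : K) :
    (m * n %| #|K|.-1)%N -> u \in unity_roots K n ->
  exists2 w, w \in unity_roots K (m * n) & w ^+ m = u.
Proof.
case/prim_root_exists=> z prim_z; rewrite inE => /eqP un1.
have := dvdn_prim_root prim_z (dvdn_mull m (dvdnn n)).
have /[1!muln_gt0]/andP[m_gt0 n_gt0] := prim_order_gt0 prim_z.
rewrite mulnK // => prim_zm; have [i ->] := prim_rootP prim_zm un1.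
exists (z ^+ i); last by rewrite exprAC.
by rewrite inE exprAC (prim_expr_order prim_z) expr1n.
Qed.

(** Each fiber of the [m]-th power map over [S] is a coset of the group of [m]-th roots of unity. *)
Lemma card_unity_roots_preim (K : finFieldType) (m n : nat) (S : {set K}) :
    (m * n %| #|K|.-1)%N -> S \subset unity_roots K n ->
  #|[set y : K | y ^+ m \in S]| = (m * #|S|)%N.
Proof.
move=> dvd_mn sS.
have mn_gt0 : (0 < m * n)%N.
  by have [z] := prim_root_exists dvd_mn; apply: prim_order_gt0.
rewrite -sum1_card (partition_big (fun y => y ^+ m) (mem S)) /=; last first.
  by move=> y; rewrite inE.
rewrite mulnC -sum_nat_const; apply: eq_bigr => u Su.
have [w w_root wm] := unity_rootsX dvd_mn (subsetP sS u Su).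
have nz_w := unity_roots_neq0 mn_gt0 w_root.
have cardUm := card_unity_roots (dvdn_trans (dvdn_mulr n (dvdnn m)) dvd_mn).
rewrite sum1_card -[RHS]cardUm -[RHS](card_imset _ (mulfI nz_w)).
apply: eq_card => y.
rewrite unfold_in inE; apply/andP/imsetP=> [[_ /eqP ym]|[x + ->]].
  exists (y / w); last by rewrite mulrC divfK.
  by rewrite inE expr_div_n ym wm divff // -wm expf_neq0.
by rewrite inE exprMn wm => /eqP->; rewrite mulr1.
Qed.

(** * The subfield of order [q], with [m] standing for [(q - 1) / c] *)

Variables (K : finFieldType) (q c m : nat).
Hypotheses (c_gt0 : (0 < c)%N) (m_gt0 : (0 < m)%N).
Hypotheses (def_q : q = (m * c).+1) (cardK : #|K| = (q ^ 2)%N).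
Hypothesis pchar_q : [pchar K].-nat q.

Let cardK1 : #|K|.-1 = (c * (m * q.+1))%N.
Proof. by rewrite cardK def_q; lia. Qed.

(** The fixed field of the Frobenius map of the quadratic extension, that is, the copy of F_q in
    [K]. *)
Definition subfield : {set K} := [set x | x ^+ q == x].
Local Notation F := subfield.

Lemma subfieldE : F = 0 |: unity_roots K (m * c).
Proof.
apply/setP=> x; rewrite !inE def_q exprS.
have [-> | nz_x] := eqVneq x 0; first by rewrite mul0r eqxx.
by rewrite -{3}[x]mulr1 (inj_eq (mulfI nz_x)).
Qed.

Lemma card_subfield : #|F| = q.
Proof.
rewrite subfieldE cardsU1 inE expr0n gtn_eqF ?muln_gt0 ?m_gt0 //.
rewrite eq_sym oner_eq0 card_unity_roots ?def_q // cardK1 mulnA [(c * m)%N]mulnC.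
exact: dvdn_mulr.
Qed.

Lemma subfieldB x y : x \in F -> y \in F -> x - y \in F.
Proof.
rewrite !inE => /eqP Fx /eqP Fy; have := exprDn_pchar (x - y) y pchar_q.
by rewrite subrK Fx Fy => {2}->; rewrite addrK.
Qed.

Lemma subfieldM x y : x \in F -> y \in F -> x * y \in F.
Proof. by rewrite !inE exprMn => /eqP-> /eqP->. Qed.

Lemma subfieldV x : x \in F -> x^-1 \in F.
Proof. by rewrite !inE exprVn => /eqP->. Qed.

Lemma subfield1 : 1 \in F.
Proof. by rewrite inE expr1n. Qed.

Lemma unity_roots_subfield z : z ^+ (m * c) = 1 -> z \in F.
Proof. by move=> z1; rewrite subfieldE !inE z1 eqxx orbT. Qed.

Lemma notin_subfield : exists w, w \notin F.
Proof.
have /subsetPn[w _ Fw] : ~~ ([set: K] \subset F); last by exists w.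
apply/negP=> /subset_leq_card; rewrite cardsT card_subfield cardK; nia.
Qed.

(** * Affine lines avoiding 0 *)

Section Lines.

Variables (w : K) (Fw : w \notin F).

(** One line avoiding 0, parametrized by [F]; its multiples by nonzero scalars of [K] are all the
    lines avoiding 0. *)
Let line (f : K) : K := 1 + f * w.

Lemma subfield_free a b : a \in F -> b \in F -> a + b * w = 0 -> a = 0 /\ b = 0.
Proof.
move=> Fa Fb; have [-> | nz_b] := eqVneq b 0; first by rewrite mul0r addr0.
move=> eq0; case/negP: Fw; rewrite -[w](mulKf nz_b) -[b * w](addKr a) eq0 addr0.
by rewrite subfieldM ?subfieldV // -[- a]sub0r subfieldB // -(subrr a) subfieldB.
Qed.

Lemma line_neq0 f : f \in F -> line f != 0.
Proof.
move=> Ff; apply/eqP=> /(subfield_free subfield1 Ff)[/eqP].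
by rewrite oner_eq0.
Qed.

Lemma line_scale r f g :
  r \in F -> f \in F -> g \in F -> r * line f = line g -> r = 1 /\ f = g.
Proof.
move=> Fr Ff Fg eq_rfg.
have [|||/subr0_eq r1 /subr0_eq] := @subfield_free (r - 1) (r * f - g).
- by rewrite subfieldB ?subfield1.
- by rewrite subfieldB ?subfieldM.
- by rewrite mulrBl -addrACA -opprD -/(line g) -eq_rfg mulrDr mulr1 mulrA subrr.
- by rewrite r1 mul1r.
Qed.

(** Subtracting the two relations cancels the constant terms and puts [r] in [F], where [line_scale]
    applies. *)
Lemma line_meet r f1 f2 g1 g2 :
    f1 \in F -> f2 \in F -> g1 \in F -> g2 \in F ->
    r * line f1 = line g1 -> r * line f2 = line g2 -> f1 != f2 ->
  r = 1.
Proof.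
move=> Ff1 Ff2 Fg1 Fg2 eq1 eq2 neq_f; rewrite -subr_eq0 in neq_f.
have nz_w : w != 0.
  by apply: contraNneq Fw => ->; rewrite -(subrr 1) subfieldB ?subfield1.
have eq_fg : r * (f1 - f2) = g1 - g2.
  apply: (mulIf nz_w).
  have -> : r * (f1 - f2) * w = r * line f1 - r * line f2 by rewrite /line; ring.
  by rewrite eq1 eq2 /line; ring.
have Fr : r \in F.
  by rewrite -[r](mulfK neq_f) eq_fg subfieldM ?subfieldV ?subfieldB.
by have [] := line_scale Fr Ff1 Fg1 eq1.
Qed.

(** The ratio of the two points is an [n]-th root of unity, hence lies in [F], and a line avoiding 0
    has no two points proportional over [F]. *)
Lemma line_ratio n f g : (n %| m * c)%N -> f \in F -> g \in F ->
  line f ^+ n = line g ^+ n -> f = g.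
Proof.
case/dvdnP=> k def_mc Ff Fg eq_n; have nz_f := line_neq0 Ff.
have Fr : line g / line f \in F.
  apply: unity_roots_subfield.
  by rewrite def_mc mulnC exprM expr_div_n eq_n divff ?expr1n ?expf_neq0 ?line_neq0.
by have [] := line_scale Fr Ff Fg (divfK nz_f _).
Qed.

(** * The blocks and their intersections *)

Let points : {set K} := 0 |: unity_roots K (m * q.+1).

Lemma card_points : #|points| = (m * q.+1 + 1)%N.
Proof.
rewrite cardsU1 inE expr0n gtn_eqF ?muln_gt0 ?m_gt0 //.
by rewrite eq_sym oner_eq0 card_unity_roots ?addn1 // cardK1 dvdn_mull.
Qed.

(* The image of the line s^(1/c) * (1 + F w) under x |-> x ^ c. *)
Definition line_block (s : K) : {set K} := [set s * line f ^+ c | f in F].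

(* The lines through 0 are the fibers of x |-> x ^ (q - 1), which is y ^ m for
   y = x ^ c. *)
Definition pencil_block (S : {set K}) : {set K} := 0 |: [set y | y ^+ m \in S].

Lemma line_block_sub s : s \in unity_roots K (m * q.+1) ->
  line_block s \subset unity_roots K (m * q.+1).
Proof.
rewrite inE => /eqP s1; apply/subsetP=> _ /imsetP[f Ff ->].
rewrite inE exprMn s1 mul1r -exprM -cardK1.
apply/eqP/(mulfI (line_neq0 Ff)); rewrite mulr1 -exprS prednK ?expf_card //.
exact: ltnW (finNzRing_gt1 K).
Qed.

Lemma card_line_block s : s != 0 -> #|line_block s| = q.
Proof.
move=> nz_s; rewrite card_in_imset ?card_subfield // => f g Ff Fg /(mulfI nz_s).
exact: (line_ratio (dvdn_mull m (dvdnn c))).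
Qed.

(* With rho ^ c = s / t, the parameter f of a common point satisfies
   zeta * rho * line f = line g for some c-th root of unity zeta, and zeta
   determines f because two distinct lines meet at most once. *)
Lemma card_line_blockI s t :
    s \in unity_roots K (m * q.+1) -> t \in unity_roots K (m * q.+1) -> s != t ->
  (#|line_block s :&: line_block t| <= c)%N.
Proof.
move=> s_root t_root neq_st.
have mq_gt0 : (0 < m * q.+1)%N by rewrite muln_gt0 m_gt0.
have nz_t := unity_roots_neq0 mq_gt0 t_root.
have [||rho _ rho_c] := @unity_rootsX K c (m * q.+1) (s / t).
- by rewrite cardK1.
- by move: s_root t_root; rewrite !inE expr_div_n => /eqP-> /eqP->; rewrite divr1.
have rho_neq1 : rho ^+ c != 1.
  by rewrite rho_c; apply: contraNneq neq_st => /divr1_eq->.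
pose is_pt zeta f := (f \in F) && (zeta * rho * line f \in [set line g | g in F]).
(* The default 0 occurs only when [zeta] yields no common point; it is harmless, since the image of
   [pt] serves as an upper bound. *)
pose pt zeta := s * line (odflt 0 [pick f | is_pt zeta f]) ^+ c.
have <- : #|unity_roots K c| = c by rewrite card_unity_roots // cardK1 dvdn_mulr.
apply: leq_trans (leq_imset_card pt _); apply/subset_leq_card/subsetP=> y.
case/setIP=> /imsetP[f Ff ->] /imsetP[g Fg eq_fg].
have eq_fg1 : (rho * line f) ^+ c = line g ^+ c.
  by apply: (mulfI nz_t); rewrite -eq_fg exprMn rho_c mulrA [t * _]mulrC divfK.
have nz_rf : rho * line f != 0.
  apply: contraNneq (expf_neq0 c (line_neq0 Fg)) => rf0.
  by rewrite -eq_fg1 rf0 expr0n gtn_eqF.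
pose zeta := line g / (rho * line f).
have zeta1 : zeta ^+ c = 1 by rewrite expr_div_n eq_fg1 divff ?expf_neq0 ?line_neq0.
have pt_f : is_pt zeta f.
  by rewrite /is_pt Ff -mulrA divfK //; apply: imset_f.
apply/imsetP; exists zeta; first by rewrite inE zeta1.
rewrite /pt; case: pickP => [f' | /(_ f)]; last by rewrite pt_f.
case/andP=> Ff' /imsetP[g' Fg' eq_fg'] /=.
(* Distinct parameters for one [zeta] would force [zeta * rho = 1], hence [rho ^+ c = 1]. *)
have [-> // | neq_f] := eqVneq f f'; case/eqP: rho_neq1.
have /andP[_ /imsetP[g1 Fg1 eq_fg2]] := pt_f.
have /(congr1 (fun x => x ^+ c)) := line_meet Ff Ff' Fg1 Fg' eq_fg2 eq_fg' neq_f.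
by rewrite exprMn zeta1 mul1r expr1n.
Qed.

Lemma card_pencil_block (S : {set K}) :
  S \subset unity_roots K q.+1 -> #|S| = c -> #|pencil_block S| = q.
Proof.
move=> sS cardS.
have S0 : 0 \notin S.
  by apply/negP=> /(subsetP sS)/(unity_roots_neq0 (ltn0Sn q)); rewrite eqxx.
rewrite cardsU1 inE expr0n gtn_eqF // S0 (card_unity_roots_preim _ sS).
  by rewrite cardS def_q.
by rewrite cardK1 dvdn_mull.
Qed.

Lemma pencil_block_sub (S : {set K}) :
  S \subset unity_roots K q.+1 -> pencil_block S \subset points.
Proof.
move=> sS; apply: setUS; apply/subsetP=> y; rewrite !inE => /(subsetP sS).
by rewrite inE exprM.
Qed.

(** A line avoiding 0 meets each line through 0 at most once: [y ^+ m] is injective on the line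
    block, by [line_ratio] with exponent [q - 1], and sends the common points into [S]. *)
Lemma card_line_pencilI s (S : {set K}) : s \in unity_roots K (m * q.+1) ->
  (#|line_block s :&: pencil_block S| <= #|S|)%N.
Proof.
move=> s_root.
have mq_gt0 : (0 < m * q.+1)%N by rewrite muln_gt0 m_gt0.
have nz_s := unity_roots_neq0 mq_gt0 s_root.
rewrite -(@card_in_imset _ _ (fun y => y ^+ m)).
  apply/subset_leq_card/subsetP=> _ /imsetP[y /setIP[By Sy] ->].
  have nz_y := unity_roots_neq0 mq_gt0 (subsetP (line_block_sub s_root) y By).
  by move: Sy; rewrite !inE (negPf nz_y).
move=> _ _ /setIP[/imsetP[f Ff ->] _] /setIP[/imsetP[g Fg ->] _].
rewrite !exprMn -!exprM => /(mulfI (expf_neq0 m nz_s)).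
by rewrite mulnC => /(line_ratio (dvdnn _) Ff Fg) ->.
Qed.

Lemma card_pencil_blockI (S T : {set K}) :
  [disjoint S & T] -> (#|pencil_block S :&: pencil_block T| <= 1)%N.
Proof.
move=> disjST; rewrite -(cards1 (0 : K)); apply/subset_leq_card/subsetP=> y.
rewrite !inE; case: eqP => //= _ /andP[Sy Ty].
by have := disjointFr disjST Sy; rewrite Ty.
Qed.

End Lines.

(** * Assembling the packing *)

Lemma packing_number_lines :
  (m * q.+1 + q.+1 %/ c <= packing_number (m * q.+1 + 1) q (c + 1))%N.
Proof.
have [w Fw] := notin_subfield.
have c_lt_q : (c < q)%N by rewrite def_q ltnS leq_pmull.
have cardU : #|unity_roots K q.+1| = q.+1.
  by rewrite card_unity_roots // cardK1 mulnA dvdn_mull.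
have cardM : #|unity_roots K (m * q.+1)| = (m * q.+1)%N.
  by rewrite card_unity_roots // cardK1 dvdn_mull.
have := disjoint_subsets (unity_roots K q.+1) c.
rewrite cardU => -[S [sS cardS disjS]].
(* The left summand indexes the line blocks, the right one the groups of [c] lines through 0. *)
pose I := ({s | s \in unity_roots K (m * q.+1)} + 'I_(q.+1 %/ c))%type.
pose B (i : I) := match i with
  | inl s => line_block w (val s) | inr j => pencil_block (S j) end.
have -> : (m * q.+1 + q.+1 %/ c)%N = #|{: I}|.
  by rewrite card_sum card_ord card_sig cardM.
have root_neq0 := @unity_roots_neq0 K (m * q.+1).
rewrite -card_points; apply: (packing_number_ge (B := B)) => //.
- case=> [[s s_root] | j] /=; last exact: pencil_block_sub.
  by rewrite (subset_trans (line_block_sub Fw s_root)) ?subsetUr.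
- case=> [[s s_root] | j] /=; last exact: card_pencil_block.
  by rewrite card_line_block // root_neq0 // muln_gt0 m_gt0.
- case=> [[s s_root] | i] [[t t_root] | j] //= neq_ij.
  + exact: card_line_blockI.
  + by rewrite -(cardS j) card_line_pencilI.
  + by rewrite setIC -(cardS i) card_line_pencilI.
  + by rewrite (leq_trans (card_pencil_blockI _)) ?disjS.
Qed.

End Blocks.

Theorem mainTheorem2 (c q : nat) (hc : 1 <= c) (hq : prime_power q)
    (hcq : c < q - 1) (hdvd : c %| q - 1) :
  packing_number ((q ^ 2 - 1) %/ c + 1) q (c + 1)
    >= (q ^ 2 - 1) %/ c + (q + 1) %/ c.
Proof.
have [p [n [pr_p n_gt0 def_q]]] := hq.
have n2_gt0 : 0 < n * 2 by rewrite muln_gt0 n_gt0.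
(* The exponent [n * 2] makes [K] a field of order [q ^ 2]. *)
have [K pcharK cardK] := finfield.pPrimePowerField pr_p n2_gt0.
have pchar_q : ([pchar K]%R).-nat q.
  by rewrite def_q (eq_pnat _ (GRing.pcharf_eq pcharK)) pnatX pnat_id.
have [m def_m] := dvdnP hdvd.
have def_qS : q = (m * c).+1 by lia.
have m_gt0 : 0 < m by case: m def_m {def_qS} => // def_m; lia.
have -> : (q ^ 2 - 1) %/ c = m * q.+1.
  have -> : q ^ 2 - 1 = m * q.+1 * c by rewrite def_qS; lia.
  by rewrite mulnK.
rewrite (addn1 q); apply: (packing_number_lines hc m_gt0 def_qS _ pchar_q).
by rewrite cardK def_q expnM.
Qed.
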